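(* Suppose $T$ and $C$ are props and $f \colon T \to C$ is a symmetric monoidal functor. Then $f$ is isomorphic, in the 2-category $\mathrm{SymmMonCat}$ (that is, via a monoidal natural isomorphism), to a strict symmetric monoidal functor $g \colon T \to C$. If $f(1) = 1$, then $g$ can be taken to be a morphism of props.
   Context: A prop is a strict symmetric monoidal category having the natural numbers as objects, with the tensor product of objects given by addition. A morphism of props is a strict symmetric monoidal functor that is the identity on objects. $\mathrm{SymmMonCat}$ is the 2-category whose objects are symmetric monoidal categories, whose morphisms are symmetric monoidal functors (in the ''weak'' sense, called ''strong'' by Mac Lane: tensor product and unit are preserved up to coherent natural isomorphism), and whose 2-morphisms are monoidal natural transformations. *)

(* Defs.v *)
Set Implicit Arguments.
Unset Strict Implicit.
Unset Printing Implicit Defensive.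

Declare Scope smc_scope.
Delimit Scope smc_scope with smc.
Local Open Scope smc_scope.

(* The type of objects is a parameter, and below so are the tensor product on
   objects and the unit object: a prop can then have nat, + and 0 in these
   places definitionally, with no transport along an equality of types. *)
Record category (O : Type) : Type := Category {
  hom : O -> O -> Type;
  idm : forall a, hom a a;
  comp : forall a b c, hom b c -> hom a b -> hom a c;
  comp_idl : forall a b (f : hom a b), comp (idm b) f = f;
  comp_idr : forall a b (f : hom a b), comp f (idm a) = f;
  comp_assoc : forall a b c d (h : hom c d) (g : hom b c) (f : hom a b),
    comp h (comp g f) = comp (comp h g) f
}.

Notation "g ∘ f" := (comp g f) (at level 40, left associativity) : smc_scope.

Record iso (O : Type) (C : category O) (a b : O) : Type := Iso {
  iso_hom :> hom C a b;
  iso_inv : hom C b a;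
  iso_homK : iso_inv ∘ iso_hom = idm C a;
  iso_invK : iso_hom ∘ iso_inv = idm C b
}.

(* A morphism a -> b with a = b only propositionally is an identity when it
   becomes one once b is replaced by a. *)
Inductive is_identity (O : Type) (C : category O) (a : O) :
    forall b : O, hom C a b -> Prop :=
  IsIdentity : is_identity (idm C a).

Record symMonCat (O : Type) (tens : O -> O -> O) (unit : O) : Type := SymMonCat {
  smc_cat :> category O;
  tensm : forall a b c d,
    hom smc_cat a b -> hom smc_cat c d -> hom smc_cat (tens a c) (tens b d);
  tensm_id : forall a b,
    tensm (idm smc_cat a) (idm smc_cat b) = idm smc_cat (tens a b);
  tensm_comp : forall a b c a' b' c'
      (g : hom smc_cat b c) (f : hom smc_cat a b)
      (g' : hom smc_cat b' c') (f' : hom smc_cat a' b'),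
    tensm (g ∘ f) (g' ∘ f') = tensm g g' ∘ tensm f f';

  associator : forall a b c,
    iso smc_cat (tens (tens a b) c) (tens a (tens b c));
  lunitor : forall a, iso smc_cat (tens unit a) a;
  runitor : forall a, iso smc_cat (tens a unit) a;
  braiding : forall a b, iso smc_cat (tens a b) (tens b a);

  associator_nat : forall a b c a' b' c'
      (f : hom smc_cat a a') (g : hom smc_cat b b') (h : hom smc_cat c c'),
    associator a' b' c' ∘ tensm (tensm f g) h
    = tensm f (tensm g h) ∘ associator a b c;
  lunitor_nat : forall a b (f : hom smc_cat a b),
    lunitor b ∘ tensm (idm smc_cat unit) f = f ∘ lunitor a;
  runitor_nat : forall a b (f : hom smc_cat a b),
    runitor b ∘ tensm f (idm smc_cat unit) = f ∘ runitor a;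
  braiding_nat : forall a b a' b' (f : hom smc_cat a a') (g : hom smc_cat b b'),
    braiding a' b' ∘ tensm f g = tensm g f ∘ braiding a b;

  pentagon : forall a b c d,
    associator a b (tens c d) ∘ associator (tens a b) c d
    = tensm (idm smc_cat a) (associator b c d)
      ∘ associator a (tens b c) d
      ∘ tensm (associator a b c) (idm smc_cat d);
  triangle : forall a b,
    tensm (idm smc_cat a) (lunitor b) ∘ associator a unit b
    = tensm (runitor a) (idm smc_cat b);
  hexagon : forall a b c,
    associator b c a ∘ braiding a (tens b c) ∘ associator a b c
    = tensm (idm smc_cat b) (braiding a c)
      ∘ associator b a c
      ∘ tensm (braiding a b) (idm smc_cat c);
  braiding_sym : forall a b, braiding b a ∘ braiding a b = idm smc_cat (tens a b)
}.

(* Strictness says nothing about the braiding. *)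
Record is_strict (O : Type) (tens : O -> O -> O) (unit : O)
    (M : symMonCat tens unit) : Prop := IsStrict {
  strict_associator : forall a b c, is_identity (associator M a b c);
  strict_lunitor : forall a, is_identity (lunitor M a);
  strict_runitor : forall a, is_identity (runitor M a)
}.

(* The unit must be 0: strictness gives unit + n = n. *)
Record prop : Type := MkProp {
  prop_smc :> symMonCat Nat.add 0;
  prop_strict : is_strict prop_smc
}.

Section Functors.
Context (O : Type) (tens : O -> O -> O) (unit : O).
Context (O' : Type) (tens' : O' -> O' -> O') (unit' : O').
Context (M : symMonCat tens unit) (N : symMonCat tens' unit').

Record symMonFunctor : Type := SymMonFunctor {
  fob :> O -> O';
  fmap : forall a b, hom M a b -> hom N (fob a) (fob b);
  fmap_id : forall a, fmap (idm M a) = idm N (fob a);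
  fmap_comp : forall a b c (g : hom M b c) (f : hom M a b),
    fmap (g ∘ f) = fmap g ∘ fmap f;

  ftens : forall a b, iso N (tens' (fob a) (fob b)) (fob (tens a b));
  funit : iso N unit' (fob unit);

  ftens_nat : forall a b a' b' (f : hom M a a') (g : hom M b b'),
    ftens a' b' ∘ tensm (fmap f) (fmap g) = fmap (tensm f g) ∘ ftens a b;
  ftens_associator : forall a b c,
    fmap (associator M a b c)
      ∘ ftens (tens a b) c
      ∘ tensm (ftens a b) (idm N (fob c))
    = ftens a (tens b c)
      ∘ tensm (idm N (fob a)) (ftens b c)
      ∘ associator N (fob a) (fob b) (fob c);
  ftens_lunitor : forall a,
    fmap (lunitor M a) ∘ ftens unit a ∘ tensm funit (idm N (fob a))
    = lunitor N (fob a);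
  ftens_runitor : forall a,
    fmap (runitor M a) ∘ ftens a unit ∘ tensm (idm N (fob a)) funit
    = runitor N (fob a);
  ftens_braiding : forall a b,
    fmap (braiding M a b) ∘ ftens a b
    = ftens b a ∘ braiding N (fob a) (fob b)
}.

Record is_strict_functor (F : symMonFunctor) : Prop := IsStrictFunctor {
  strict_ftens : forall a b, is_identity (ftens F a b);
  strict_funit : is_identity (funit F)
}.

Record monNatTrans (F G : symMonFunctor) : Type := MonNatTrans {
  ntc :> forall a, hom N (F a) (G a);
  ntc_nat : forall a b (f : hom M a b), ntc b ∘ fmap F f = fmap G f ∘ ntc a;
  ntc_tens : forall a b,
    ntc (tens a b) ∘ ftens F a b = ftens G a b ∘ tensm (ntc a) (ntc b);
  ntc_unit : ntc unit ∘ funit F = funit G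
}.

(* Isomorphism of 1-cells in SymmMonCat: identities, vertical composites and
   equality of monoidal transformations are componentwise. *)
Definition mon_isomorphic (F G : symMonFunctor) : Prop :=
  exists (t : monNatTrans F G) (u : monNatTrans G F),
    (forall a, u a ∘ t a = idm N (F a)) /\ (forall a, t a ∘ u a = idm N (G a)).

End Functors.

Definition is_prop_morphism (T C : prop) (g : symMonFunctor T C) : Prop :=
  is_strict_functor g /\ forall n, g n = n.

(* Main.v *)
Require Import Defs.

Local Open Scope smc_scope.

(** The functor [g] is [f] transported along isomorphisms [t n : g n -> f n],
    where [g n] is the [n]-fold sum of [f 1] and [t] is the iterated coherence
    isomorphism of [f]:  [t 0] is the unit constraint and
    [t (1 + n) = ftens f 1 n ∘ (id ⊗ t n)].  Any family of isomorphisms into the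
    values of a symmetric monoidal functor transports the whole structure to a
    new functor and becomes a monoidal isomorphism ([transport],
    [transport_isomorphic]), so only strictness is left.

    Strictness is not a matter of computing the constraints of [g], which live
    over equalities between natural numbers that do not hold by conversion.
    Instead, the axioms of the functor [g] are read as equations between
    composites in which every arrow but one is known to be an identity, and the
    remaining arrow is cancelled out.  Unitality ([ftens_unit_is_identity])
    gives the constraint at [(0, b)].  Associativity
    ([ftens_tens_is_identity]) at [(1, a, b)] gives the one at [(1 + a, b)] from the
    one at [(a, b)], as soon as the constraints at [(1, _)] are identities
    ([sum_ftens_1]); these reduce to [t 1 : f 1 + 0 -> f 1] being an identity, which
    is unitality of [f].  Finally, if [f 1 = 1] then the [n]-fold sum of [f 1]
    is [n], so the same [g] is a morphism of props. *)

(** * Arrows that are identities *)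

Section Identities.
Context {O : Type} {C : category O}.

Lemma is_identity_comp {a b c} (g : hom C b c) (f : hom C a b) :
  is_identity g -> is_identity f -> is_identity (g ∘ f).
Proof. intros [] Hf. rewrite comp_idl. exact Hf. Qed.

Lemma is_identity_cancel_l {a b c} (g : hom C b c) (f : hom C a b) :
  is_identity g -> is_identity (g ∘ f) -> is_identity f.
Proof. intros [] H. rewrite comp_idl in H. exact H. Qed.

Lemma is_identity_cancel_r {a b c} (g : hom C b c) (f : hom C a b) :
  is_identity f -> is_identity (g ∘ f) -> is_identity g.
Proof. intros Hf. destruct Hf. rewrite comp_idr. trivial. Qed.

End Identities.

Lemma is_identity_tensm {O : Type} {tens : O -> O -> O} {unit : O}
    (M : symMonCat tens unit) {a b c d} (f : hom M a b) (g : hom M c d) :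
  is_identity f -> is_identity g -> is_identity (tensm f g).
Proof. intros [] []. rewrite tensm_id. constructor. Qed.

Lemma is_identity_fmap {O O' : Type}
    {tens : O -> O -> O} {unit : O} {tens' : O' -> O' -> O'} {unit' : O'}
    {M : symMonCat tens unit} {N : symMonCat tens' unit'}
    (F : symMonFunctor M N) {a b} (h : hom M a b) :
  is_identity h -> is_identity (fmap F h).
Proof. intros []. rewrite fmap_id. constructor. Qed.

(** * Isomorphisms and tensor products of arrows *)

Section Isomorphisms.
Context {O : Type} {C : category O}.

Definition iso_id (a : O) : iso C a a :=
  Iso (comp_idl (idm C a)) (comp_idl (idm C a)).

Definition iso_sym {a b} (i : iso C a b) : iso C b a :=
  Iso (iso_invK i) (iso_homK i).

Lemma comp_iso_homK {a b c} (i : iso C a b) (u : hom C a c) :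
  u ∘ iso_inv i ∘ i = u.
Proof. rewrite <- comp_assoc, iso_homK. apply comp_idr. Qed.

Lemma comp_iso_invK {a b c} (i : iso C a b) (u : hom C b c) :
  u ∘ i ∘ iso_inv i = u.
Proof. rewrite <- comp_assoc, iso_invK. apply comp_idr. Qed.

Lemma iso_mono {a b c} (i : iso C b c) (u v : hom C a b) :
  i ∘ u = i ∘ v -> u = v.
Proof.
  intros H. rewrite <- (comp_idl u), <- (comp_idl v), <- (iso_homK i).
  rewrite <- !comp_assoc, H. reflexivity.
Qed.

Lemma iso_comp_homK {a b c} (j : iso C b c) (i : iso C a b) :
  iso_inv i ∘ iso_inv j ∘ (j ∘ i) = idm C a.
Proof. rewrite comp_assoc, comp_iso_homK. apply iso_homK. Qed.

Lemma iso_comp_invK {a b c} (j : iso C b c) (i : iso C a b) :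
  j ∘ i ∘ (iso_inv i ∘ iso_inv j) = idm C c.
Proof. rewrite comp_assoc, comp_iso_invK. apply iso_invK. Qed.

Definition iso_comp {a b c} (j : iso C b c) (i : iso C a b) : iso C a c :=
  Iso (iso_comp_homK j i) (iso_comp_invK j i).

End Isomorphisms.

Section Tensor.
Context {O : Type} {tens : O -> O -> O} {unit : O} {M : symMonCat tens unit}.

Lemma tensm_comp_l {a b c d e} (g : hom M b c) (f : hom M a b) (h : hom M d e) :
  tensm (g ∘ f) h = tensm g (idm M e) ∘ tensm f h.
Proof. rewrite <- tensm_comp, comp_idl. reflexivity. Qed.

Lemma tensm_comp_r {a b c d e} (g : hom M b c) (f : hom M a b) (h : hom M d e) :
  tensm h (g ∘ f) = tensm (idm M e) g ∘ tensm h f.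
Proof. rewrite <- tensm_comp, comp_idl. reflexivity. Qed.

Context {a b c d : O} (i : iso M a b) (j : iso M c d).

Lemma iso_tens_homK :
  tensm (iso_inv i) (iso_inv j) ∘ tensm i j = idm M (tens a c).
Proof. rewrite <- tensm_comp, !iso_homK. apply tensm_id. Qed.

Lemma iso_tens_invK :
  tensm i j ∘ tensm (iso_inv i) (iso_inv j) = idm M (tens b d).
Proof. rewrite <- tensm_comp, !iso_invK. apply tensm_id. Qed.

Definition iso_tens : iso M (tens a c) (tens b d) :=
  Iso iso_tens_homK iso_tens_invK.

End Tensor.

(** * Transport of a symmetric monoidal functor along isomorphisms *)

Section Transport.
Context {O : Type} {tens : O -> O -> O} {unit : O}.
Context {O' : Type} {tens' : O' -> O' -> O'} {unit' : O'}.
Context {M : symMonCat tens unit} {N : symMonCat tens' unit'}.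
Context (F : symMonFunctor M N) (G : O -> O').
Context (t : forall a, iso N (G a) (F a)).

Definition transport_map a b (h : hom M a b) : hom N (G a) (G b) :=
  iso_inv (t b) ∘ (fmap F h ∘ t a).

Definition transport_tens a b : iso N (tens' (G a) (G b)) (G (tens a b)) :=
  iso_comp (iso_sym (t (tens a b)))
    (iso_comp (ftens F a b) (iso_tens (t a) (t b))).

Definition transport_unit : iso N unit' (G unit) :=
  iso_comp (iso_sym (t unit)) (funit F).

Lemma transport_mapE a b (h : hom M a b) :
  t b ∘ transport_map a b h = fmap F h ∘ t a.
Proof.
  unfold transport_map. rewrite comp_assoc, iso_invK. apply comp_idl.
Qed.

Lemma transport_tensE a b :
  t (tens a b) ∘ transport_tens a b = ftens F a b ∘ tensm (t a) (t b).
Proof. simpl. rewrite comp_assoc, iso_invK. apply comp_idl. Qed.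

Lemma comp_transport_tensE a b c (u : hom N (F (tens a b)) c) :
  u ∘ t (tens a b) ∘ transport_tens a b
  = u ∘ ftens F a b ∘ tensm (t a) (t b).
Proof. rewrite <- comp_assoc, transport_tensE. apply comp_assoc. Qed.

Lemma transport_unitE : t unit ∘ transport_unit = funit F.
Proof. simpl. rewrite comp_assoc, iso_invK. apply comp_idl. Qed.

(** Each axiom below is checked after composing with the isomorphism [t]: the
    three equations above then move [t] through both sides, where it turns
    the transported structure into that of [F], until the axiom for [F]
    applies. *)
Lemma transport_map_id a : transport_map a a (idm M a) = idm N (G a).
Proof.
  apply (iso_mono (t a)). rewrite transport_mapE, fmap_id, comp_idl, comp_idr.
  reflexivity.
Qed.

Lemma transport_map_comp a b c (g : hom M b c) (f : hom M a b) :
  transport_map a c (g ∘ f) = transport_map b c g ∘ transport_map a b f.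
Proof.
  apply (iso_mono (t c)). rewrite comp_assoc, !transport_mapE, fmap_comp.
  rewrite <- !comp_assoc, transport_mapE. reflexivity.
Qed.

Lemma transport_tens_nat a b a' b' (f : hom M a a') (g : hom M b b') :
  transport_tens a' b'
    ∘ tensm (transport_map a a' f) (transport_map b b' g)
  = transport_map _ _ (tensm f g) ∘ transport_tens a b.
Proof.
  apply (iso_mono (t _)).
  rewrite !comp_assoc, transport_tensE, transport_mapE, comp_transport_tensE.
  rewrite <- ftens_nat, <- !comp_assoc, <- !tensm_comp, !transport_mapE.
  reflexivity.
Qed.

Lemma transport_associator a b c :
  transport_map _ _ (associator M a b c)
    ∘ transport_tens (tens a b) c
    ∘ tensm (transport_tens a b) (idm N (G c))
  = transport_tens a (tens b c)
    ∘ tensm (idm N (G a)) (transport_tens b c)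
    ∘ associator N (G a) (G b) (G c).
Proof.
  apply (iso_mono (t _)).
  rewrite !comp_assoc, transport_mapE, comp_transport_tensE, transport_tensE.
  rewrite <- (comp_assoc _ (tensm (t (tens a b)) (t c))), <- tensm_comp.
  rewrite <- (comp_assoc _ (tensm (t a) (t (tens b c)))), <- tensm_comp.
  rewrite !transport_tensE, !comp_idr, tensm_comp_l, tensm_comp_r.
  rewrite !comp_assoc, ftens_associator.
  rewrite <- !comp_assoc, associator_nat. reflexivity.
Qed.

Lemma transport_lunitor a :
  transport_map _ _ (lunitor M a)
    ∘ transport_tens unit a
    ∘ tensm transport_unit (idm N (G a))
  = lunitor N (G a).
Proof.
  apply (iso_mono (t _)).
  rewrite !comp_assoc, transport_mapE, comp_transport_tensE.
  rewrite <- lunitor_nat, <- ftens_lunitor.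
  rewrite <- !comp_assoc, <- !tensm_comp, transport_unitE, !comp_idl, !comp_idr.
  reflexivity.
Qed.

Lemma transport_runitor a :
  transport_map _ _ (runitor M a)
    ∘ transport_tens a unit
    ∘ tensm (idm N (G a)) transport_unit
  = runitor N (G a).
Proof.
  apply (iso_mono (t _)).
  rewrite !comp_assoc, transport_mapE, comp_transport_tensE.
  rewrite <- runitor_nat, <- ftens_runitor.
  rewrite <- !comp_assoc, <- !tensm_comp, transport_unitE, !comp_idl, !comp_idr.
  reflexivity.
Qed.

Lemma transport_braiding a b :
  transport_map _ _ (braiding M a b) ∘ transport_tens a b
  = transport_tens b a ∘ braiding N (G a) (G b).
Proof.
  apply (iso_mono (t _)).
  rewrite !comp_assoc, transport_mapE, comp_transport_tensE, transport_tensE.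
  rewrite ftens_braiding, <- !comp_assoc, braiding_nat. reflexivity.
Qed.

Definition transport : symMonFunctor M N :=
  SymMonFunctor transport_map_id transport_map_comp transport_tens_nat
    transport_associator transport_lunitor transport_runitor
    transport_braiding.

Lemma transport_inv_nat a b (h : hom M a b) :
  iso_inv (t b) ∘ fmap F h = fmap transport h ∘ iso_inv (t a).
Proof.
  simpl. unfold transport_map.
  rewrite <- !comp_assoc, iso_invK, comp_idr. reflexivity.
Qed.

Lemma transport_inv_tens a b :
  iso_inv (t (tens a b)) ∘ ftens F a b
  = ftens transport a b ∘ tensm (iso_inv (t a)) (iso_inv (t b)).
Proof.
  simpl. rewrite <- !comp_assoc, <- tensm_comp, !iso_invK, tensm_id, comp_idr.
  reflexivity.
Qed.

Lemma transport_isomorphic : mon_isomorphic F transport.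
Proof.
  exists (MonNatTrans (F := F) (G := transport) (ntc := fun a => iso_inv (t a))
    transport_inv_nat transport_inv_tens eq_refl).
  exists (MonNatTrans (F := transport) (G := F) (ntc := t)
    transport_mapE transport_tensE transport_unitE).
  split; intro a; [apply iso_invK | apply iso_homK].
Qed.

End Transport.

(** * Constraints of functors between strict categories *)

Section StrictEnds.
Context {O : Type} {tens : O -> O -> O} {unit : O}.
Context {O' : Type} {tens' : O' -> O' -> O'} {unit' : O'}.
Context {M : symMonCat tens unit} {N : symMonCat tens' unit'}.
Context (HM : is_strict M) (HN : is_strict N) (F : symMonFunctor M N).

(** In the left unitality axiom of [F] both unitors are identities; only the
    tensor constraint is left once the unit constraint is one as well. *)
Lemma ftens_unit_is_identity b :
  is_identity (funit F) -> is_identity (ftens F unit b).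
Proof.
  intros H0.
  apply (is_identity_cancel_l (fmap F (lunitor M b))).
  { apply is_identity_fmap, (strict_lunitor HM). }
  apply (is_identity_cancel_r _ (tensm (funit F) (idm N (F b)))).
  { apply is_identity_tensm; [exact H0 | constructor]. }
  rewrite ftens_lunitor. apply (strict_lunitor HN).
Qed.

(** The associativity axiom of [F] at [(a, b, c)] relates four constraints
    through associators that are identities, so three of them determine the
    fourth. *)
Lemma ftens_tens_is_identity a b c :
  is_identity (ftens F a b) -> is_identity (ftens F b c) ->
  is_identity (ftens F a (tens b c)) -> is_identity (ftens F (tens a b) c).
Proof.
  intros Hab Hbc Habc.
  apply (is_identity_cancel_l (fmap F (associator M a b c))).
  { apply is_identity_fmap, (strict_associator HM). }
  apply (is_identity_cancel_r _ (tensm (ftens F a b) (idm N (F c)))).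
  { apply is_identity_tensm; [exact Hab | constructor]. }
  rewrite ftens_associator.
  apply is_identity_comp; [apply is_identity_comp |].
  - exact Habc.
  - apply is_identity_tensm; [constructor | exact Hbc].
  - apply (strict_associator HN).
Qed.

End StrictEnds.

(** * The strict functor with the same value at 1 *)

Section Strictification.
Context {T C : prop} (f : symMonFunctor T C).

(** The sum is bracketed to the right because [1 + n] is [S n] by conversion,
    so that [sum_iso] can end at [f (S n)] without a cast. *)
Fixpoint sum_ob (n : nat) : nat :=
  match n with 0 => 0 | S n => f 1 + sum_ob n end.

Fixpoint sum_iso (n : nat) : iso C (sum_ob n) (f n) :=
  match n with
  | 0 => funit f
  | S n => iso_comp (ftens f 1 n) (iso_tens (iso_id (f 1)) (sum_iso n))
  end.

Definition sum_functor : symMonFunctor T C := transport f sum_ob sum_iso.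

(** This is right unitality of [f]:  [fmap f (runitor T 1) ∘ sum_iso 1] is the
    right unitor of [C] at [f 1]. *)
Lemma sum_iso_1 : is_identity (sum_iso 1).
Proof.
  apply (is_identity_cancel_l (fmap f (runitor T 1))).
  - apply is_identity_fmap, (strict_runitor (prop_strict T)).
  - pose proof (strict_runitor (prop_strict C) (f 1)) as H.
    rewrite <- (ftens_runitor f 1), <- comp_assoc in H. exact H.
Qed.

(** [sum_iso (1 + a)] was defined through [ftens f 1 a], which therefore
    cancels and leaves [sum_iso 1 ⊗ id]. *)
Lemma sum_ftens_1 a : is_identity (ftens sum_functor 1 a).
Proof.
  assert (H : iso_hom (ftens sum_functor 1 a)
              = tensm (sum_iso 1) (idm C (sum_ob a))).
  { apply (iso_mono (sum_iso (S a))).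
    etransitivity; [exact (transport_tensE f sum_ob sum_iso 1 a) |].
    change (iso_hom (sum_iso (S a)))
      with (ftens f 1 a ∘ tensm (idm C (f 1)) (sum_iso a)).
    rewrite <- comp_assoc, <- tensm_comp, comp_idl, comp_idr. reflexivity. }
  rewrite H.
  exact (is_identity_tensm C _ _ sum_iso_1 (IsIdentity C (sum_ob a))).
Qed.

Lemma sum_funit : is_identity (funit sum_functor).
Proof. simpl. rewrite iso_homK. constructor. Qed.

Lemma sum_ftens a b : is_identity (ftens sum_functor a b).
Proof.
  induction a as [|a IH].
  - exact (ftens_unit_is_identity (prop_strict T) (prop_strict C)
             sum_functor b sum_funit).
  - exact (ftens_tens_is_identity (prop_strict T) (prop_strict C)
             sum_functor 1 a b (sum_ftens_1 a) IH (sum_ftens_1 (a + b))).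
Qed.

Lemma sum_functor_strict : is_strict_functor sum_functor.
Proof. split; [exact sum_ftens | exact sum_funit]. Qed.

Lemma sum_ob_id : f 1 = 1 -> forall n, sum_ob n = n.
Proof.
  intros H n. induction n as [|n IH]; simpl; [| rewrite H, IH]; reflexivity.
Qed.

End Strictification.

Theorem proposition4p4 (T C : prop) (f : symMonFunctor T C) :
  (exists g : symMonFunctor T C, is_strict_functor g /\ mon_isomorphic f g) /\
  (f 1 = 1 ->
   exists g : symMonFunctor T C, is_prop_morphism g /\ mon_isomorphic f g).
Proof.
  assert (Hiso : mon_isomorphic f (sum_functor f)) by apply transport_isomorphic.
  split.
  - exists (sum_functor f). split; [apply sum_functor_strict | exact Hiso].
  - intros H1. exists (sum_functor f). split; [split | exact Hiso].
    + apply sum_functor_strict.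
    + exact (sum_ob_id f H1).
Qed.
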